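(* Let $-1<q<1$ and let $b_q=b_{|q|}=\prod_{i=1}^{\infty}\frac{1+|q|^i}{1-|q|^i}<\infty$. Let $c=c_1^{(q)}$ be a $q$-circular operator. Then for every $n\in\mathbb{N}$, \[\|c^n\|\ge b_q^{-1}\sqrt{n+1}\,\|c^n\|_2 .\]
   Context: Let $H=\mathbb{C}\oplus\mathbb{C}$ with orthonormal basis $e,\overline e$. Inner products are linear in the first variable. On the algebraic Fock space $\bigoplus_{n\ge0}H^{\otimes n}$ ($H^{\otimes 0}=\mathbb{C}\Omega$ with $\Omega$ a unit vector) the $q$-inner product is, for $\xi\in H^{\otimes m},\eta\in H^{\otimes n}$, $\langle \xi,\eta\rangle_q=\delta_{m,n}\langle P^{(m)}\xi,\eta\rangle_{H^{\otimes m}}$, where $P^{(m)}(\xi_1\otimes\cdots\otimes\xi_m)=\sum_{\pi\in S_m}q^{\mathrm{inv}(\pi)}\xi_{\pi(1)}\otimes\cdots\otimes\xi_{\pi(m)}$ and $\mathrm{inv}(\pi)$ is the number of inversions of $\pi$ (convention $0^0=1$). It is positive definite for $-1<q<1$; the completion is the $q$-Fock space $\mathcal{F}_q(H)$. For $\xi\in H$, $a(\xi)\eta_1\otimes\cdots\otimes\eta_n=\xi\otimes\eta_1\otimes\cdots\otimes\eta_n$, $a(\xi)\Omega=\xi$, and $a^*(\xi)\eta_1\otimes\cdots\otimes\eta_n=\sum_{k=1}^n q^{k-1}\langle\eta_k,\xi\rangle\,\eta_1\otimes\cdots\otimes\eta_{k-1}\otimes\eta_{k+1}\otimes\cdots\otimes\eta_n$,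 $a^*(\xi)\Omega=0$; these extend to bounded, mutually adjoint operators on $\mathcal{F}_q(H)$. The $q$-circular operator is $c=a(e)+a^*(\overline e)$. $\|\cdot\|$ is the operator norm on $B(\mathcal{F}_q(H))$ and $\|T\|_2=\|T\Omega\|_{\mathcal{F}_q(H)}=\langle T^*T\Omega,\Omega\rangle_q^{1/2}$. *)

(* Defs.v *)
From HB Require Import structures.
From mathcomp Require Import all_boot all_order all_algebra all_fingroup.
From mathcomp Require Import complex.
From mathcomp Require Import all_classical all_reals all_analysis.

Set Implicit Arguments.
Unset Strict Implicit.
Unset Printing Implicit Defensive.

Import Order.TTheory GRing.Theory Num.Theory.
Import numFieldNormedType.Exports.

Local Open Scope classical_set_scope.
Local Open Scope ring_scope.
Local Open Scope complex_scope.

Definition hsp (R : realType) := 'rV[R[i]]_2.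

Definition hbasis (R : realType) (j : 'I_2) : hsp R := delta_mx 0 j.

Definition hdot (R : realType) (x y : hsp R) : R[i] :=
  \sum_(j < 2) x 0 j * (y 0 j)^*%C.

(* The basis e_{w 0} (x) ... (x) e_{w (n-1)} of the n-th tensor power is
   indexed by the words w of length n in the two letters 0 (for e) and 1
   (for \bar e); a tensor is the function giving its coordinates. *)
Definition word (n : nat) := {ffun 'I_n -> 'I_2}.

Definition tpow (R : realType) (n : nat) := {ffun word n -> (R[i])^o}.

Definition ptens (R : realType) (n : nat) (xi : 'I_n -> hsp R) : tpow R n :=
  [ffun w : word n => \prod_(i < n) xi i 0 (w i)].

Definition lin_ext (R : realType) (n m : nat) (f : word n -> tpow R m)
    (x : tpow R n) : tpow R m :=
  \sum_(w : word n) x w *: f w.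

Definition tdot (R : realType) (n : nat) (x y : tpow R n) : R[i] :=
  \sum_(w : word n) x w * (y w)^*%C.

Definition hcons (R : realType) (n : nat) (xi : hsp R) (eta : 'I_n -> hsp R) :
    'I_n.+1 -> hsp R :=
  fun i => if unlift ord0 i is Some j then eta j else xi.

Definition inversions (n : nat) (s : {perm 'I_n}) : nat :=
  #|[pred ij : 'I_n * 'I_n | (ij.1 < ij.2)%N && (s ij.2 < s ij.1)%N]|.

Definition qsym (R : realType) (q : R) (n : nat) : tpow R n -> tpow R n :=
  lin_ext (fun w =>
    \sum_(s : {perm 'I_n})
       (q ^+ inversions s)%:C *: ptens (fun i => hbasis R (w (s i)))).

Definition create (R : realType) (n : nat) (xi : hsp R) :
    tpow R n -> tpow R n.+1 :=
  lin_ext (fun w => ptens (hcons xi (fun i => hbasis R (w i)))).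

(* k is counted from 0, whence q ^+ k rather than q ^+ k.-1. *)
Definition annihilate (R : realType) (q : R) (n : nat) (xi : hsp R) :
    tpow R n.+1 -> tpow R n :=
  lin_ext (fun w =>
    \sum_(k < n.+1)
       ((q ^+ k)%:C * hdot (hbasis R (w k)) xi) *:
         ptens (fun i => hbasis R (w (lift k i)))).

Section PureTensors.
Variable R : realType.

Lemma hbasisE (j k : 'I_2) : hbasis R j 0 k = (k == j)%:R.
Proof. by rewrite /hbasis mxE eqxx. Qed.

Lemma tdot_ptens n (xi eta : 'I_n -> hsp R) :
  tdot (ptens xi) (ptens eta) = \prod_(i < n) hdot (xi i) (eta i).
Proof.
rewrite /hdot bigA_distr_bigA /=; apply: eq_bigr => w _.
by rewrite !ffunE big_split /= rmorph_prod.
Qed.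

Lemma qsym_ptens (q : R) n (xi : 'I_n -> hsp R) :
  qsym q (ptens xi) =
  \sum_(s : {perm 'I_n}) (q ^+ inversions s)%:C *: ptens (fun i => xi (s i)).
Proof.
rewrite /qsym /lin_ext.
under eq_bigr do rewrite scaler_sumr.
rewrite exchange_big /=; apply: eq_bigr => s _.
under eq_bigr do rewrite scalerA mulrC -scalerA.
rewrite -scaler_sumr; congr (_ *: _); apply/ffunP => v.
rewrite sum_ffunE !ffunE.
transitivity (\prod_(i < n) \sum_(j < 2) (xi (s i) 0 j * (v i == j)%:R)).
  rewrite [RHS](reindex_inj (@perm_inj _ (s^-1)%g)) /= bigA_distr_bigA /=.
  apply: eq_bigr => w _; rewrite !ffunE [RHS]big_split /=; congr (_ * _).
    by apply: eq_bigr => i _; rewrite permKV.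
  rewrite [LHS](reindex_inj (@perm_inj _ (s^-1)%g)) /=.
  by apply: eq_bigr => i _; rewrite hbasisE permKV.
apply: eq_bigr => i _; rewrite (bigD1 (v i)) //= eqxx mulr1 big1 ?addr0 //.
by move=> j /negPf; rewrite eq_sym => ->; rewrite mulr0.
Qed.

Lemma create_ptens n (xi : hsp R) (eta : 'I_n -> hsp R) :
  create xi (ptens eta) = ptens (hcons xi eta).
Proof.
apply/ffunP => v; rewrite /create /lin_ext sum_ffunE !ffunE.
rewrite big_ord_recl /hcons unlift_none.
transitivity (xi 0 (v ord0) *
   \prod_(i < n) \sum_(j < 2) (eta i 0 j * (v (lift ord0 i) == j)%:R)).
  rewrite bigA_distr_bigA mulr_sumr /=; apply: eq_bigr => w _.
  rewrite !ffunE big_ord_recl unlift_none big_split /= /GRing.scale /= mulrCA.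
  by do 2!congr (_ * _); apply: eq_bigr => i _; rewrite liftK hbasisE.
congr (_ * _); apply: eq_bigr => i _; rewrite liftK.
rewrite (bigD1 (v (lift ord0 i))) //= eqxx mulr1 big1 ?addr0 //.
by move=> j /negPf; rewrite eq_sym => ->; rewrite mulr0.
Qed.

Lemma annihilate_ptens (q : R) n (xi : hsp R) (eta : 'I_n.+1 -> hsp R) :
  annihilate q xi (ptens eta) =
  \sum_(k < n.+1) ((q ^+ k)%:C * hdot (eta k) xi) *:
     ptens (fun i => eta (lift k i)).
Proof.
rewrite /annihilate /lin_ext.
under eq_bigr do rewrite scaler_sumr.
rewrite exchange_big /=; apply: eq_bigr => k _.
under eq_bigr do rewrite scalerA mulrCA -scalerA.
rewrite -scaler_sumr -scalerA; congr (_ *: _); apply/ffunP => v.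
rewrite sum_ffunE !ffunE /GRing.scale /=.
pose F (i : 'I_n.+1) (j : 'I_2) : R[i] :=
  eta i 0 j * (if unlift k i is Some i' then (v i' == j)%:R
               else (xi 0 j)^*%C).
transitivity (\prod_(i < n.+1) \sum_(j < 2) F i j).
  rewrite bigA_distr_bigA /=; apply: eq_bigr => w _.
  rewrite !ffunE /GRing.scale /= /F big_split /= -mulrA; congr (_ * _).
  rewrite [RHS](bigD1_ord k) //= unlift_none; congr (_ * _).
    rewrite /hdot (bigD1 (w k)) //= hbasisE eqxx mul1r big1 ?addr0 //.
    by move=> j /negPf; rewrite hbasisE => ->; rewrite mul0r.
  by apply: eq_bigr => i _; rewrite liftK hbasisE.
rewrite (bigD1_ord k) //= /F unlift_none; congr (_ * _).
apply: eq_bigr => i _; rewrite liftK.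
rewrite (bigD1 (v i)) //= eqxx mulr1 big1 ?addr0 //.
by move=> j /negPf; rewrite eq_sym => ->; rewrite mulr0.
Qed.

End PureTensors.

(* Each tensor power is finite dimensional, hence complete for the q-norm when
   -1 < q < 1, so the completion of the algebraic Fock space is the l^2-direct
   sum of the tensor powers: the sequences of tensors of finite q-norm
   [qfock]. The operators below preserve this set when -1 < q < 1, and there
   they are the continuous extensions of the operators on the algebraic Fock
   space, since the n-th component of the result depends only on finitely many
   components of the argument. *)
Definition graded (R : realType) := forall n : nat, tpow R n.

Definition qdot (R : realType) (q : R) (n : nat) (x y : tpow R n) : R[i] :=
  tdot (qsym q x) y.

Definition qnorm (R : realType) (q : R) (x : graded R) : \bar R :=
  sqrte (\sum_(0 <= n <oo) (complex.Re (qdot q (x n) (x n)))%:E)%E.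

Definition qfock (R : realType) (q : R) : set (graded R) :=
  [set x | (qnorm q x < +oo)%E].

Definition vacuum (R : realType) : graded R :=
  fun n => if n is 0 then [ffun=> 1] else 0.

Definition creation (R : realType) (xi : hsp R) (x : graded R) : graded R :=
  fun n => if n is m.+1 then create xi (x m) else 0.

Definition annihilation (R : realType) (q : R) (xi : hsp R) (x : graded R) :
    graded R :=
  fun n => annihilate q xi (x n.+1).

Definition qcircular (R : realType) (q : R) (x : graded R) : graded R :=
  fun n => creation (hbasis R 0) x n + annihilation q (hbasis R 1) x n.

(* T is defined on all sequences; only its restriction to [qfock q] matters.
   The value is +oo when that restriction is unbounded. *)
Definition opnorm (R : realType) (q : R) (T : graded R -> graded R) : \bar R :=
  ereal_sup [set qnorm q (T x) | x in qfock q `&` [set x | (qnorm q x <= 1)%E]].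

Definition norm2 (R : realType) (q : R) (T : graded R -> graded R) : \bar R :=
  qnorm q (T (vacuum R)).

Definition bconst (R : realType) (q : R) : \bar R :=
  limn (fun N => (\prod_(1 <= i < N.+1)
                    ((1 + `|q| ^+ i) / (1 - `|q| ^+ i)))%:E).

(* Main.v *)
Require Import Defs.
From mathcomp Require Import all_boot all_order all_algebra all_fingroup.
From mathcomp Require Import complex ring lra zify.
From mathcomp Require Import all_classical all_reals all_analysis.

Set Implicit Arguments.
Unset Strict Implicit.
Unset Printing Implicit Defensive.

Import Order.TTheory GRing.Theory Num.Theory.
Local Open Scope ring_scope.

(** Testing the operator norm on the single vector
    [\bar e^{(x) n} / |\bar e^{(x) n}|_q] is enough.  Since [a^*(\bar e)] kills
    every letter [e], it q-commutes with [a(e)]: [a^*(\bar e) a(e) =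
    q a(e) a^*(\bar e)].  The q-binomial theorem therefore gives
    [c^n = \sum_k binom(n,k)_q a(e)^(n-k) a^*(\bar e)^k], hence
    [c^n \bar e^{(x) n} = \sum_k binom(n,k)_q ([n]! / [n-k]!)
    e^{(x) (n-k)} (x) \bar e^{(x) (n-k)}], where the terms have different degrees
    and so are orthogonal.  Permutations that contribute to the q-norm of
    [e^{(x) a} (x) \bar e^{(x) b}] preserve the two blocks, so the square of that
    norm is [[a]! [b]!].  As [|\bar e^{(x) n}|_q^2 = [n]!], this yields
    [|c^n|^2 >= [n]! \sum_k binom(n,k)_q^2], while [c^n Omega = e^{(x) n}] gives
    [|c^n|_2^2 = [n]!].

    It remains to see that each of the [n+1] Gaussian binomials is at least
    [1 / b_q].  Written as the product of the [k] quotients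
    [(1 - q^(n-i)) / (1 - q^(k-i))], it is bounded below factor by factor by
    [(1 - |q|^(k-i)) / (1 + |q|^(k-i))], whose product is the inverse of a partial
    product of [b_q] ([qbinom_ge]).

    The vectors [c^j \bar e^{(x) n}] are computed by induction on [j]
    ([iter_qcircular]), the induction step being the Pascal rule [qbinomS].  Norms
    of blocks come from the recursion [qdot_hcons] for the q-inner product, and
    [qnorm_orbit] assembles both; its case [n = 0] is the orbit of the
    vacuum. *)

(** * Partial products of the constant *)

Section PartialProducts.
Variables (R : realType) (q : R).

Definition bprod N : R :=
  \prod_(1 <= i < N.+1) ((1 + `|q| ^+ i) / (1 - `|q| ^+ i)).

Lemma bprod0 : bprod 0 = 1.
Proof. by rewrite /bprod big_geq. Qed.

Hypothesis hq : -1 < q < 1.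

Let q1 : `|q| < 1. Proof. by rewrite ltr_norml. Qed.

Let qi1 i : 0 < 1 - `|q| ^+ i.+1.
Proof. by rewrite subr_gt0 exprn_ilt1. Qed.

Lemma bprod_nondecreasing : {homo bprod : m n / (m <= n)%N >-> m <= n}.
Proof.
apply: homo_leq => // [|n]; first exact: le_trans.
rewrite /bprod [leRHS]big_nat_recr //= ler_peMr //.
  rewrite big_nat_cond prodr_ge0 // => -[|i] // _.
  by rewrite divr_ge0 ?(ltW (qi1 _)) ?addr_ge0.
by rewrite ler_pdivlMr // mul1r lerD2l (@le_trans _ _ 0) // oppr_le0 exprn_ge0.
Qed.

Lemma bprod_gt0 N : 0 < bprod N.
Proof.
by apply: lt_le_trans (bprod_nondecreasing (leq0n N)); rewrite bprod0.
Qed.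

(** From [(1 + x) / (1 - x) = 1 + 2 x / (1 - x) <= expR (2 x / (1 - |q|))] for
    [x = |q|^i], and a geometric series in the exponent. *)
Lemma bprod_le N : bprod N <= expR (2 / (1 - `|q|) * (1 - `|q|)^-1).
Proof.
have e0 : 0 < 1 - `|q| by rewrite subr_gt0.
apply: (@le_trans _ _ (\prod_(1 <= i < N.+1) expR (2 / (1 - `|q|) * `|q| ^+ i))).
  rewrite /bprod !big_add1 /= !big_mkord; apply: ler_prod => i _.
  have p0 : 0 <= `|q| ^+ i.+1 by rewrite exprn_ge0.
  have p1 : `|q| ^+ i.+1 <= `|q| by rewrite exprS ler_piMr // exprn_ile1 // ltW.
  rewrite divr_ge0 ?(ltW (qi1 _)) ?addr_ge0 //=.
  apply: le_trans (expR_ge1Dx _); rewrite ler_pdivrMr //.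
  have -> : (1 + 2 / (1 - `|q|) * `|q| ^+ i.+1) * (1 - `|q| ^+ i.+1) =
    1 - `|q| ^+ i.+1 +
      2 * `|q| ^+ i.+1 * ((1 - `|q| ^+ i.+1) / (1 - `|q|)) by field; rewrite gt_eqF.
  have : 1 <= (1 - `|q| ^+ i.+1) / (1 - `|q|).
    by rewrite ler_pdivlMr // mul1r lerD2l lerN2.
  by nra.
rewrite -expR_sum ler_expR -mulr_sumr ler_wpM2l ?divr_ge0 ?(ltW e0) //.
rewrite -[leRHS]mul1r ler_pdivlMr // big_add1 /= big_mkord.
have := subrX1 `|q| N.+1; rewrite big_ord_recl expr0 => h.
under eq_bigr do rewrite -[_.+1]/(bump 0 _).
set S := (\sum_(i < N) _) in h *; have : 0 <= `|q| ^+ N.+1 by rewrite exprn_ge0.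
by nra.
Qed.

Lemma bconst_fin_num : (bconst q < +oo)%E /\
  forall N, bprod N <= fine (bconst q).
Proof.
have nd : nondecreasing_seq (fun N => (bprod N)%:E).
  by move=> m n mn; rewrite lee_fin bprod_nondecreasing.
have cv := ereal_nondecreasing_is_cvgn nd.
have b_lt : (bconst q < +oo)%E.
  apply: (@le_lt_trans _ _ (expR (2 / (1 - `|q|) * (1 - `|q|)^-1))%:E).
    by apply: lime_le => //; apply: nearW => N; rewrite lee_fin bprod_le.
  exact: ltry.
have b_ge N : ((bprod N)%:E <= bconst q)%E.
  rewrite /bconst (cvg_lim _ (ereal_nondecreasing_cvgn nd)) //.
  by apply: ereal_sup_ubound; exists N.
split=> // N; rewrite -lee_fin fineK // ge0_fin_numE //.
by apply: le_trans (b_ge 0); rewrite lee_fin bprod0.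
Qed.

End PartialProducts.

(** * q-integers and Gaussian binomials *)

Section QNumbers.
Variables (R : realType) (q : R).

Definition qint n : R := \sum_(i < n) q ^+ i.

Definition qfact n : R := \prod_(i < n) qint i.+1.

(** The falling q-factorial [[n]! / [n-k]!]; the truncated subtraction makes it
    vanish for [n < k]. *)
Definition qffact n k : R := \prod_(i < k) qint (n - i).

(** The Gaussian binomial.  Pairing [n - i] with [k - i], rather than with
    [i + 1], makes the quotients comparable one by one with those of [b_q]; the
    truncated subtraction makes the product vanish for [n < k]. *)
Definition qbinom n k : R :=
  \prod_(i < k) ((1 - q ^+ (n - i)) / (1 - q ^+ (k - i))).

Lemma qfact0 : qfact 0 = 1.
Proof. by rewrite /qfact big_ord0. Qed.

Lemma qfactS n : qfact n.+1 = qfact n * qint n.+1.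
Proof. by rewrite /qfact big_ord_recr. Qed.

Lemma qffact0 n k : (n < k)%N -> qffact n k = 0.
Proof.
by move=> nk; rewrite /qffact (bigD1 (Ordinal nk)) //= subnn /qint big_ord0 mul0r.
Qed.

Lemma qffactS n k : qffact n k.+1 = qffact n k * qint (n - k).
Proof. by rewrite /qffact big_ord_recr. Qed.

Lemma qffactK n k : (k <= n)%N -> qffact n k * qfact (n - k) = qfact n.
Proof.
elim: k => [|k IHk] kn; first by rewrite /qffact big_ord0 mul1r subn0.
rewrite -IHk 1?ltnW // qffactS -mulrA; congr (_ * _).
have -> : (n - k = (n - k.+1).+1)%N by lia.
by rewrite qfactS mulrC.
Qed.

(** The weight that annihilation collects from [n - a] equal letters which come
    after [a] letters that it kills. *)
Lemma qint_block (a n : nat) :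
  \sum_(k < n) q ^+ k * (a <= k)%:R = q ^+ a * qint (n - a).
Proof.
rewrite /qint mulr_sumr.
rewrite -(big_mkord xpredT (fun k => q ^+ k * (a <= k)%:R)).
have [an|na] := leqP a n; last first.
  rewrite (eqP (ltnW na)) big_ord0 big_nat_cond big1 // => k /andP[/andP[_ kn] _].
  by rewrite leqNgt (ltn_trans kn na) mulr0.
rewrite (big_cat_nat (n := a)) //= big_nat_cond big1 ?add0r => [|k]; last first.
  by move=> /andP[/andP[_ ka] _]; rewrite leqNgt ka mulr0.
rewrite -{1}(add0n a) big_addn big_mkord; apply: eq_bigr => i _.
by rewrite leq_addl mulr1 addnC exprD.
Qed.

Hypothesis hq : -1 < q < 1.

Lemma qpow_lt1 n : 0 < 1 - q ^+ n.+1.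
Proof.
rewrite subr_gt0; apply: le_lt_trans (ler_norm _) _.
by rewrite normrX exprn_ilt1 // ltr_norml.
Qed.

Lemma qint_gt0 n : 0 < qint n.+1.
Proof.
have := qpow_lt1 n; rewrite -opprB subrX1 -mulNr opprB pmulr_rgt0 //.
by rewrite subr_gt0; case/andP: hq.
Qed.

Lemma qfact_gt0 n : 0 < qfact n.
Proof. by apply: prodr_gt0 => i _; exact: qint_gt0. Qed.

Lemma qbinomE n k :
  qbinom n k * \prod_(i < k) (1 - q ^+ i.+1) = \prod_(i < k) (1 - q ^+ (n - i)).
Proof.
rewrite [X in _ * X](reindex_inj rev_ord_inj) -big_split /=.
apply: eq_bigr => i _; rewrite -subSn // subSS.
have -> : (k - i = (k - i).-1.+1)%N by have := ltn_ord i; lia.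
by rewrite divfK // gt_eqF ?qpow_lt1.
Qed.

Lemma qbinom0 n k : (n < k)%N -> qbinom n k = 0.
Proof.
by move=> nk; rewrite /qbinom (bigD1 (Ordinal nk)) //= subnn expr0 subrr !mul0r.
Qed.

(** Pascal rule; the power of [q] is the cost of moving one more
    [a^*(\bar e)] past [n - k] copies of [a(e)]. *)
Lemma qbinomS n k :
  qbinom n.+1 k.+1 = qbinom n k.+1 + q ^+ (n - k) * qbinom n k.
Proof.
have D_neq0 m : \prod_(i < m) (1 - q ^+ i.+1) != 0.
  by apply/prodf_neq0 => i _; rewrite gt_eqF ?qpow_lt1.
apply: (mulIf (D_neq0 k.+1)); rewrite mulrDl !qbinomE.
rewrite [X in _ + _ * X]big_ord_recr /= mulrA -[q ^+ _ * _ * _]mulrA qbinomE.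
rewrite big_ord_recl subn0 [X in _ = X + _]big_ord_recr /=.
under eq_bigr do rewrite /bump /= add1n subSS.
have [kn|nk] := leqP k n.
  have -> : q ^+ n.+1 = q ^+ (n - k) * q ^+ k.+1 by rewrite -exprD addnS subnK.
  ring.
by rewrite (bigD1 (Ordinal nk)) //= subnn expr0 subrr; ring.
Qed.

(** Factor by factor, [1 - q^(n-i) >= 1 - |q|^(k-i)], which uses [k <= n], and
    [1 - q^(k-i) <= 1 + |q|^(k-i)]. *)
Lemma qbinom_ge n k : (k <= n)%N -> (bprod q k)^-1 <= qbinom n k.
Proof.
move=> kn; have q1 : `|q| < 1 by rewrite ltr_norml.
rewrite /bprod big_add1 /= big_mkord (reindex_inj rev_ord_inj) /= -prodfV.
apply: ler_prod => i _; have := ltn_ord i.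
rewrite -subSn // subSS -subn_gt0; case: (k - i)%N (leq_sub2r i kn) => // m mn _.
have pm : `|q| ^+ m.+1 < 1 by rewrite exprn_ilt1.
have nm : `|q| ^+ (n - i) <= `|q| ^+ m.+1.
  by apply: ler_wiXn2l => //; exact: ltW.
have le1 : 1 - q ^+ m.+1 <= 1 + `|q| ^+ m.+1.
  by rewrite lerD2l -normrX -normrN ler_norm.
have le2 : 1 - `|q| ^+ m.+1 <= 1 - q ^+ (n - i).
  rewrite lerD2l lerN2; apply: le_trans nm; rewrite -normrX; exact: ler_norm.
have p0 : 0 <= `|q| ^+ m.+1 by rewrite exprn_ge0.
rewrite invf_div divr_ge0 ?subr_ge0 ?(ltW pm) ?addr_ge0 //=.
apply: ler_pM => //; rewrite ?subr_ge0 ?(ltW pm) ?invr_ge0 ?addr_ge0 //.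
by rewrite lef_pV2 ?posrE ?qpow_lt1 // ltr_pwDl.
Qed.

End QNumbers.

(** * Recursion for the q-inner product *)

Section QInnerProduct.
Local Open Scope complex_scope.
Variables (R : realType) (q : R).

(** The index [k] is the one sent to [0], so it forms an inversion with exactly
    the [k] indices before it; the other inversions are those of [s]. *)
Lemma inversions_lift_perm n (k : 'I_n.+1) (s : {perm 'I_n}) :
  inversions (lift_perm k ord0 s) = (k + inversions s)%N.
Proof.
have inversionsE m (t : {perm 'I_m}) :
    inversions t = (\sum_(i < m) \sum_(j < m) ((i < j) && (t j < t i)))%N.
  rewrite /inversions -sum1_card big_mkcond pair_big /=.
  by apply: eq_bigr => -[i j] _; rewrite inE /=; case: ifP.
have ltn_lift (i j : 'I_n) : (lift k i < lift k j)%N = (i < j)%N.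
  by rewrite /= /bump; do 2!case: leqP; lia.
rewrite !inversionsE (bigD1_ord k) //= big1 ?add0n => [|j _]; last first.
  by rewrite lift_perm_id /= ltn0 andbF.
under eq_bigr => i _ do rewrite (bigD1_ord k) //= lift_perm_id lift_perm_lift.
rewrite big_split /=; congr (_ + _)%N.
  transitivity (\sum_(i < n) (i < k)%N)%N.
    by apply: eq_bigr => i _; rewrite /= /bump /=; case: leqP; lia.
  have sum_ltn m : (\sum_(i < m) (i < k)%N)%N = minn m k.
    by elim: m => [|m IHm]; rewrite ?big_ord0 ?min0n // big_ord_recr /= IHm; lia.
  by rewrite sum_ltn (minn_idPr _) // -ltnS.
apply: eq_bigr => i _; apply: eq_bigr => j _.
by rewrite ltn_lift !lift_perm_lift.
Qed.

Lemma lift_perm_bij n :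
  bijective (fun p : 'I_n.+1 * {perm 'I_n} => lift_perm p.1 ord0 p.2).
Proof.
apply: inj_card_bij => [[k s] [k' s'] /= eq_ks|].
  have kk' : k = k'.
    apply: (@perm_inj _ (lift_perm k ord0 s)).
    by rewrite lift_perm_id eq_ks lift_perm_id.
  rewrite -{k'}kk' in eq_ks *; congr (_, _); apply/permP => i.
  by apply: (@lift_inj _ ord0); rewrite -!(lift_perm_lift k) eq_ks.
by rewrite card_prod !card_Sn card_ord factS.
Qed.

Lemma qdot_ptens n (xi eta : 'I_n -> hsp R) :
  qdot q (ptens xi) (ptens eta) =
  \sum_(s : {perm 'I_n}) (q ^+ inversions s)%:C * \prod_i hdot (xi (s i)) (eta i).
Proof.
rewrite /qdot qsym_ptens /tdot.
under eq_bigr do rewrite sum_ffunE mulr_suml.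
rewrite exchange_big /=; apply: eq_bigr => s _.
rewrite -tdot_ptens /tdot mulr_sumr; apply: eq_bigr => w _.
by rewrite !ffunE /GRing.scale /= mulrA.
Qed.

(** Removing the first letter on the left, paired with the [k]-th letter on the
    right: this is the adjointness of creation and annihilation, in the form that
    lets q-inner products be computed by induction on the degree. *)
Lemma qdot_hcons n (xi : hsp R) (xi' : 'I_n -> hsp R) (eta : 'I_n.+1 -> hsp R) :
  qdot q (ptens (hcons xi xi')) (ptens eta) =
  \sum_(k < n.+1) (q ^+ k)%:C * hdot xi (eta k) *
     qdot q (ptens xi') (ptens (fun i => eta (lift k i))).
Proof.
rewrite qdot_ptens (reindex _ (onW_bij _ (lift_perm_bij n))) /=.
rewrite -(pair_bigA _ (fun k s => (q ^+ inversions (lift_perm k ord0 s))%:C *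
  \prod_i hdot (hcons xi xi' (lift_perm k ord0 s i)) (eta i))) /=.
apply: eq_bigr => k _; rewrite qdot_ptens mulr_sumr; apply: eq_bigr => s _.
rewrite inversions_lift_perm exprD rmorphM /= (bigD1_ord k) //=.
rewrite lift_perm_id {1}/hcons unlift_none.
under eq_bigr do rewrite lift_perm_lift /hcons liftK.
by rewrite mulrACA.
Qed.

Lemma qdotZ n (a b : R) (x y : tpow R n) :
  qdot q (a%:C *: x) (b%:C *: y) = (a * b)%:C * qdot q x y.
Proof.
rewrite /qdot /qsym /lin_ext /tdot mulr_sumr; apply: eq_bigr => w _.
under eq_bigr do rewrite ffunE -scalerA.
rewrite -scaler_sumr !ffunE /GRing.scale /=.
have -> : (b%:C * y w)^*%C = b%:C * (y w)^*%C
  by rewrite rmorphM; congr (_ * _); exact: conjc_real.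
by rewrite rmorphM /=; ring.
Qed.

End QInnerProduct.

(** * Words made of two blocks *)

Section Blocks.
Local Open Scope complex_scope.
Variables (R : realType) (q : R).

Lemma eq_ptens n (xi eta : 'I_n -> hsp R) : xi =1 eta -> ptens xi = ptens eta.
Proof.
by move=> eq_xi; apply/ffunP => w; rewrite !ffunE;
  apply: eq_bigr => i _; rewrite eq_xi.
Qed.

Lemma hdot_hbasis (i j : 'I_2) : hdot (hbasis R i) (hbasis R j) = (i == j)%:R.
Proof.
rewrite /hdot (bigD1 i) //= big1 ?addr0 => [|k /negPf ki].
  by rewrite !hbasisE eqxx mul1r rmorph_nat.
by rewrite hbasisE ki mul0r.
Qed.

Lemma lin_ext_sum (I : finType) n m (f : word n -> tpow R m) (c : I -> R[i])
    (x : I -> tpow R n) :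
  lin_ext f (\sum_i c i *: x i) = \sum_i c i *: lin_ext f (x i).
Proof.
rewrite /lin_ext; under [RHS]eq_bigr do rewrite scaler_sumr.
rewrite exchange_big; apply: eq_bigr => w _.
rewrite sum_ffunE scaler_suml; apply: eq_bigr => i _.
by rewrite ffunE scalerA.
Qed.

Definition letter (a i : nat) : 'I_2 := if (i < a)%N then 0 else 1.

(** The tensor [e^{(x) a} (x) \bar e^{(x) (n - a)}].  Letters are read off a
    function on [nat], so that deleting a letter or prepending one needs no cast
    between [n] and [a + (n - a)]. *)
Definition block n a : tpow R n := ptens (fun i : 'I_n => hbasis R (letter a i)).

Lemma block_cons n a :
  block n.+1 a =
  ptens (hcons (hbasis R (letter a 0)) (fun i : 'I_n => hbasis R (letter a.-1 i))).
Proof.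
apply: eq_ptens => i; rewrite /hcons.
case: unliftP => [j|] -> //; rewrite /letter /= /bump /=.
by case: a => // a; rewrite add1n ltnS.
Qed.

Lemma create_block n a : create (hbasis R 0) (block n a) = block n.+1 a.+1.
Proof. by rewrite create_ptens block_cons. Qed.

(** Only the letters [\bar e] contribute, and deleting any one of them gives the
    same word; for [n < a] there is none, and the coefficient is [0]. *)
Lemma annihilate_block n a :
  annihilate q (hbasis R 1) (block n.+1 a) =
  (q ^+ a * qint q (n.+1 - a))%:C *: block n a.
Proof.
rewrite annihilate_ptens -qint_block rmorph_sum scaler_suml.
apply: eq_bigr => k _; rewrite hdot_hbasis rmorphM rmorph_nat /letter.
have [ka|ak] := ltnP k a; first by rewrite /= !mulr0 !scale0r.
congr (_ *: _); apply: eq_ptens => i; rewrite /letter /= /bump.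
by congr (hbasis R (if _ then _ else _)); case: leqP => //=; lia.
Qed.

(** Induction on the degree: the first letter pairs only with the letters of its
    own block, and removing any of those leaves the same word.  The weights
    [q ^+ k] of the block add up to a q-integer. *)
Lemma qdot_block n a : (a <= n)%N ->
  qdot q (block n a) (block n a) = (qfact q a * qfact q (n - a))%:C.
Proof.
elim: n a => [|n IHn] a an.
  move: an; rewrite leqn0 => /eqP ->; rewrite qdot_ptens.
  have inv0 (s : {perm 'I_0}) : inversions s = 0 by apply: eq_card0 => -[[]].
  under eq_bigr do rewrite inv0 expr0 big_ord0 mulr1.
  by rewrite sumr_const card_Sn qfact0 mulr1.
have IHa : (a.-1 <= n)%N by lia.
rewrite {1}block_cons qdot_hcons.
transitivity (\sum_(k < n.+1)
    (q ^+ k * ((a == 0) || (k < a)%N)%:R * (qfact q a.-1 * qfact q (n - a.-1)))%:C).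
  apply: eq_bigr => k _; rewrite hdot_hbasis !rmorphM /= rmorph_nat.
  have -> : letter a 0 == letter a k = (a == 0) || (k < a)%N.
    by rewrite /letter; case: a {an IHa} => // a; rewrite /=; case: ltnP.
  have [ok|] := boolP ((a == 0) || (k < a)%N); last by rewrite !mulr0 !mul0r.
  have -> : ptens (fun i : 'I_n => hbasis R (letter a (lift k i))) = block n a.-1.
    apply: eq_ptens => i; rewrite /letter /= /bump.
    by congr (hbasis R (if _ then _ else _)); case: leqP => //=; lia.
  by rewrite IHn // rmorphM.
rewrite -rmorph_sum /= -mulr_suml; congr (_ %:C).
case: a an {IHa} => [_|a an] /=.
  rewrite !subn0 qfact0 qfactS !mul1r mulrC.
  by congr (_ * _); apply: eq_bigr => i _; rewrite mulr1.
rewrite subSS qfactS mulrCA mulrA; congr (_ * _ * _).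
rewrite /qint (big_ord_widen_cond n.+1 xpredT) //.
rewrite [RHS]big_mkcond; apply: eq_bigr => i _ /=.
by case: ifP; rewrite ?mulr1 ?mulr0.
Qed.

End Blocks.

(** * Orbits of the q-circular operator *)

Section Power.
Local Open Scope complex_scope.
Variables (R : realType) (q : R).
Hypothesis hq : -1 < q < 1.

Definition orbit_coef (n j k : nat) : R := qbinom q j k * qffact q n k.

Lemma orbit_coef0 n j k : (minn n j < k)%N -> orbit_coef n j k = 0.
Proof.
rewrite /orbit_coef gtn_min => /orP[nk|jk]; first by rewrite qffact0 // mulr0.
by rewrite qbinom0 // mul0r.
Qed.

Lemma orbit_coefS n j k :
  orbit_coef n j.+1 k.+1 =
  orbit_coef n j k.+1 + q ^+ (j - k) * qint q (n - k) * orbit_coef n j k.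
Proof. by rewrite /orbit_coef qbinomS // qffactS; ring. Qed.

Lemma orbit_coef_0r n j : orbit_coef n j 0 = 1.
Proof. by rewrite /orbit_coef /qbinom /qffact !big_ord0 mulr1. Qed.

(** The orbit of [lam *: \bar e^{(x) n}] under [c].  The [k]-th term comes from
    the words in [a(e)] and [a^*(\bar e)] with [k] annihilations and [j - k]
    creations, so it lives in degree [n + j - 2 k]; this is written additively to
    avoid the truncated subtraction. *)
Definition qcircular_orbit (lam : R) (n j : nat) : graded R := fun m =>
  \sum_(k < j.+1) (lam * orbit_coef n j k * (m + k.*2 == n + j)%N%:R)%:C *:
     block R m (j - k).

Lemma annihilation_orbit lam n j m :
  annihilation q (hbasis R 1) (qcircular_orbit lam n j) m =
  \sum_(k < j.+1) (lam * (q ^+ (j - k) * qint q (n - k) * orbit_coef n j k)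
     * (m.+1 + k.*2 == n + j)%N%:R)%:C *: block R m (j - k).
Proof.
rewrite /annihilation /qcircular_orbit /annihilate lin_ext_sum.
apply: eq_bigr => k _; have := annihilate_block q m (j - k).
rewrite /annihilate => ->; rewrite scalerA -rmorphM /=; congr (_ %:C *: _).
have [deg|_] := eqVneq; last by rewrite !mulr0 mul0r.
have -> : (m.+1 - (j - k) = n - k)%N by have := ltn_ord k; lia.
by ring.
Qed.

Lemma creation_orbit lam n j m :
  creation (hbasis R 0) (qcircular_orbit lam n j) m =
  \sum_(k < j.+1) (lam * orbit_coef n j k * (m + k.*2 == n + j.+1)%N%:R)%:C *:
     block R m (j.+1 - k).
Proof.
case: m => [|m] /=.
  (* No creation lands in degree 0: [2 k = n + j + 1] forces [k] above [n]
     or [j], where the coefficient vanishes. *)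
  rewrite big1 // => k _; have [deg|_] := eqVneq; last by rewrite mulr0 scale0r.
  by rewrite orbit_coef0 ?mulr0 ?mul0r ?scale0r //; lia.
rewrite /qcircular_orbit /create lin_ext_sum; apply: eq_bigr => k _.
have := create_block R m (j - k); rewrite /create => ->.
by rewrite -subSn -1?ltnS // addSn addnS eqSS.
Qed.

(** Terms with the same number of annihilations are collected: the last operator
    applied is a creation ([k] unchanged) or an annihilation ([k] increased), and
    the two contributions add up by the Pascal rule. *)
Lemma iter_qcircular lam (n j : nat) :
  iter j (qcircular q) (fun m => (lam * (m == n)%:R)%:C *: block R m 0) =
  qcircular_orbit lam n j.
Proof.
elim: j => [|j IHj] /=; apply: functional_extensionality_dep => m.
  by rewrite /qcircular_orbit big_ord1 orbit_coef_0r mulr1 addn0 addn0.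
rewrite IHj /qcircular creation_orbit annihilation_orbit.
rewrite /qcircular_orbit [RHS]big_ord_recl [X in X + _ = _]big_ord_recl -addrA.
rewrite !orbit_coef_0r; congr (_ + _).
under [RHS]eq_bigr => k _ do rewrite lift0 orbit_coefS mulrDr mulrDl
  rmorphD scalerDl subSS.
rewrite big_split /=; congr (_ + _).
  rewrite [RHS]big_ord_recr /= (@orbit_coef0 n j j.+1) ?ltnS ?geq_minr //.
  rewrite mulr0 mul0r scale0r addr0.
  by apply: eq_bigr => k _; rewrite -[bump 0 k]/k.+1 subSS.
apply: eq_bigr => k _; congr (_ %:C *: _); congr (_ * (_ : bool)%:R).
by rewrite doubleS !addnS !addSn !eqSS.
Qed.

Lemma vacuumE : vacuum R = fun m => (1 * (m == 0)%:R)%:C *: block R m 0.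
Proof.
apply: functional_extensionality_dep => -[|m] /=; last by rewrite mulr0 scale0r.
by rewrite mulr1 scale1r; apply/ffunP => w; rewrite !ffunE big_ord0.
Qed.

(** Each degree [m] receives at most one value of [k], so there are no cross
    terms. *)
Lemma qdot_orbit lam n j m :
  complex.Re (qdot q (qcircular_orbit lam n j m) (qcircular_orbit lam n j m)) =
  \sum_(k < j.+1) (m + k.*2 == n + j)%N%:R *
     ((lam * orbit_coef n j k) ^+ 2 * (qfact q (j - k) * qfact q (n - k))).
Proof.
have [[k0 deg]|nodeg] := pselect (exists k : 'I_j.+1, m + k.*2 = n + j)%N; last first.
  have deg0 (k : 'I_j.+1) : (m + k.*2 == n + j)%N = false.
    by apply/eqP => deg; apply: nodeg; exists k.
  rewrite big1 => [|k _]; last by rewrite deg0 mul0r.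
  have -> : qcircular_orbit lam n j m = (0 : R)%:C *: 0.
    by rewrite scaler0; apply: big1 => k _; rewrite deg0 mulr0 scale0r.
  by rewrite qdotZ mul0r mul0r.
have degF (k : 'I_j.+1) : k != k0 -> (m + k.*2 == n + j)%N = false.
  by rewrite -val_eqE /= => k_neq; apply/eqP; lia.
rewrite (bigD1 k0) //= deg eqxx mul1r big1 ?addr0 => [|k k_neq]; last first.
  by rewrite degF // mul0r.
have -> : qcircular_orbit lam n j m =
    (lam * orbit_coef n j k0)%:C *: block R m (j - k0).
  rewrite /qcircular_orbit (bigD1 k0) //= deg eqxx mulr1 big1 ?addr0 // => k k_neq.
  by rewrite degF // mulr0 scale0r.
rewrite qdotZ -expr2; have [nk|kn] := ltnP n k0.
  by rewrite orbit_coef0 ?gtn_min ?nk // mulr0 expr0n /= !mul0r.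
have jk := ltn_ord k0; rewrite qdot_block; last by lia.
rewrite -rmorphM /=; congr (_ * (_ * qfact q _)); lia.
Qed.

Lemma qnorm_orbit lam n j :
  qnorm q (qcircular_orbit lam n j) =
  (Num.sqrt (\sum_(k < j.+1)
     (lam * orbit_coef n j k) ^+ 2 * (qfact q (j - k) * qfact q (n - k))))%:E.
Proof.
pose F (k : nat) := (lam * orbit_coef n j k) ^+ 2 *
  (qfact q (j - k) * qfact q (n - k)).
have F_ge0 k : 0 <= F k.
  by rewrite mulr_ge0 ?sqr_ge0 // mulr_ge0 // ltW // qfact_gt0.
rewrite /qnorm; under eq_eseriesr do rewrite qdot_orbit.
rewrite (nneseries_split _ (n + j).+1); last first.
  move=> m _; rewrite lee_fin sumr_ge0 // => k _; exact: mulr_ge0 (F_ge0 k).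
rewrite add0n eseries0 ?adde0 => [|m m_big _]; last first.
  congr _%:E; apply: big1 => k _; have [deg|_] := eqVneq; last by rewrite mul0r.
  by exfalso; lia.
rewrite sumEFin /=; congr (Num.sqrt _)%:E.
rewrite big_mkord exchange_big /=; apply: eq_bigr => k _; rewrite -mulr_suml.
have [k_big|k_small] := ltnP (minn n j) k.
  by rewrite orbit_coef0 // mulr0 expr0n /= mul0r mulr0.
have m_lt : (n + j - k.*2 < (n + j).+1)%N by rewrite ltnS leq_subr.
rewrite (bigD1 (Ordinal m_lt)) //= subnK; last by lia.
rewrite eqxx big1 ?addr0 ?mul1r // => m; rewrite -val_eqE /= => m_neq.
by have [deg|//] := eqVneq; exfalso; lia.
Qed.

End Power.

(** * Norms of the powers *)

Section PowerNorms.
Local Open Scope complex_scope.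
Variables (R : realType) (q : R).
Hypothesis hq : -1 < q < 1.

Lemma norm2_qcircular n :
  norm2 q (iter n (qcircular q)) = (Num.sqrt (qfact q n))%:E.
Proof.
rewrite /norm2 vacuumE iter_qcircular // qnorm_orbit //.
congr (Num.sqrt _)%:E; rewrite big_ord_recl big1 => [|k _]; last first.
  by rewrite orbit_coef0 ?min0n // mulr0 expr0n mul0r.
by rewrite orbit_coef_0r !subn0 qfact0 !mulr1 expr1n mul1r addr0.
Qed.

(** The lower bound is the norm of the image of the normalized
    [\bar e^{(x) n}]. *)
Lemma opnorm_qcircular_ge n :
  ((Num.sqrt (qfact q n * \sum_(k < n.+1) qbinom q n k ^+ 2))%:E <=
     opnorm q (iter n (qcircular q)))%E.
Proof.
have f_gt0 := qfact_gt0 hq n.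
pose lam := (Num.sqrt (qfact q n))^-1.
have lam2 : lam ^+ 2 = (qfact q n)^-1 by rewrite exprVn sqr_sqrtr // ltW.
pose x : graded R := fun m => (lam * (m == n)%:R)%:C *: block R m 0.
have x1 : qnorm q x = 1%E.
  rewrite -[x]/(iter 0 (qcircular q) x) iter_qcircular // qnorm_orbit //.
  rewrite big_ord1 orbit_coef_0r mulr1 !subn0 lam2 qfact0 mul1r.
  by rewrite mulVf ?gt_eqF // sqrtr1.
have -> : (Num.sqrt (qfact q n * \sum_(k < n.+1) qbinom q n k ^+ 2))%:E =
    qnorm q (iter n (qcircular q) x).
  rewrite iter_qcircular // qnorm_orbit //; congr (Num.sqrt _)%:E.
  rewrite mulr_sumr; apply: eq_bigr => k _.
  have := lt0r_neq0 f_gt0; rewrite !exprMn lam2 -(qffactK q (leq_ord k)).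
  by rewrite mulf_eq0 negb_or => /andP[? ?]; field; apply/andP.
apply: ereal_sup_ubound; exists x => //; split; rewrite /qfock /= x1 //.
exact: ltry.
Qed.

End PowerNorms.

Theorem corollary4p2 (R : realType) (q : R) (hq : -1 < q < 1) :
  (bconst q < +oo)%E /\
  forall n : nat,
    (((fine (bconst q))^-1 * Num.sqrt n.+1%:R)%:E * norm2 q (iter n (qcircular q))
       <= opnorm q (iter n (qcircular q)))%E.
Proof.
have [b_fin b_ge] := bconst_fin_num hq; split=> // n.
apply: le_trans (opnorm_qcircular_ge hq n).
rewrite norm2_qcircular // -EFinM lee_fin.
set b := fine (bconst q) in b_ge *.
have b_gt0 : 0 < b by apply: lt_le_trans (b_ge 0); rewrite bprod0.
have f_ge0 := ltW (qfact_gt0 hq n).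
have -> : b^-1 = Num.sqrt (b ^- 2) by rewrite -exprVn sqrtr_sqr gtr0_norm ?invr_gt0.
rewrite -!sqrtrM ?mulr_ge0 ?invr_ge0 ?exprn_ge0 ?(ltW b_gt0) //.
apply: ler_wsqrtr; rewrite mulrC ler_wpM2l //.
have -> : b ^- 2 * n.+1%:R = \sum_(k < n.+1) b ^- 2.
  by rewrite sumr_const card_ord mulr_natr.
apply: ler_sum => k _; rewrite -exprVn ler_sqr ?nnegrE ?invr_ge0 ?(ltW b_gt0) //.
  apply: le_trans (qbinom_ge hq (leq_ord k)).
  by rewrite lef_pV2 ?posrE // bprod_gt0.
by apply: le_trans (qbinom_ge hq (leq_ord k)); rewrite invr_ge0 ltW // bprod_gt0.
Qed.
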